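(* Let $(X_n,d_n,\{p_n^k\}_{k\in\mathbb{N}})$, $n\in\mathbb{N}$, be a sequence of sequenced Lorentzian metric spaces GH-convergent to a sequenced Lorentzian metric space $(X,d,\{p^k\}_{k\in\mathbb{N}})$. Let $\{q^k\}_{k\in\mathbb{N}}$ be another generating sequence for $X$. Then it is possible to choose for each $n\in\mathbb{N}$ a generating sequence $\{q_n^k\}_{k\in\mathbb{N}}$ for $X_n$ so that $(X_n,d_n,\{q_n^k\}_{k\in\mathbb{N}})$ GH-converges to $(X,d,\{q^k\}_{k\in\mathbb{N}})$. Moreover, suppose that there are a set $A\subset\mathbb{N}$ and a function $\rho:A\to\mathbb{N}$ such that $q^k=p^{\rho(k)}$ for every $k\in A$, and assume that at least one of the following conditions holds: (a) the image of $\rho$ is a cofinite subset of $\mathbb{N}$; (b) the set $\mathbb{N}\setminus A$ is infinite. Then the sequences $\{q_n^k\}_{k\in\mathbb{N}}$ above can be chosen so that in addition $q_n^k=p_n^{\rho(k)}$ for every $n\in\mathbb{N}$ and $k\in A$.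
   Context: Let $X$ be a set and $d:X\times X\to[0,+\infty)$ a function. Notation: $x\ll y$ iff $d(x,y)>0$; $I^+(x)=\{y: x\ll y\}$, $I^-(x)=\{y: y\ll x\}$; for $A\subset X$, $I^\pm(A)=\bigcup_{p\in A}I^\pm(p)$ and $I(A)=I^+(A)\cap I^-(A)$; $I(p^1,\dots,p^m):=I(\{p^1,\dots,p^m\})$. For $\epsilon>0$, $I_\epsilon=\{(x,y): d(x,y)\ge\epsilon\}$ and $I_\epsilon(p^1,\dots,p^m)=\{x: \exists i,j\in\{1,\dots,m\},\ d(p^i,x)\ge\epsilon,\ d(x,p^j)\ge\epsilon\}$. $(X,d)$ is a Lorentzian metric space if: (i) $d(x,z)\ge d(x,y)+d(y,z)$ whenever $d(x,y)>0$ and $d(y,z)>0$; (ii) there is a topology $T$ on $X$ such that $d$ is continuous in the product topology and, for every $x,y\in X$ and $\epsilon>0$, the set $I_\epsilon\cap(\overline{I(x,y)}\times\overline{I(x,y)})$ is compact; (iii) for all $x\ne y$ there is $z\in X$ with $d(x,z)\ne d(y,z)$ or $d(z,x)\ne d(z,y)$. A generating sequence is a sequence $\{p^k\}_{k\in\mathbb{N}}$ in $X$ with $I(\{p^k: k\in\mathbb{N}\})=X$; $(X,d,\{p^k\})$ is then a sequenced Lorentzian metric space. In this case the topology in (ii) is unique and $X$ is endowed with it. $\mathbb{N}$ does not contain $0$. For a sequenced space, $X^m:=\overline{I(p^1,\dots,p^m)}\cup\{p^1,\dots,p^m\}$. For a relation $R\subset X\times X'$ between spaces with distances $d,d'$,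 $R_1\subset X$ and $R_2\subset X'$ denote its projections, and $\mathrm{dis}\,R=\sup_{(x,x'),(y,y')\in R}|d(x,y)-d'(x',y')|$. For $m\in\mathbb{N}$, $\epsilon>0$, an $(m,\epsilon)$ $X$–$X'$ quasi-correspondence between $(X,d,\{p^k\})$ and $(X',d',\{p'^k\})$ is a compact set $R\subset X^m\times X'^m$ with $I_\epsilon(p^1,\dots,p^m)\subset R_1$, $I_\epsilon(p'^1,\dots,p'^m)\subset R_2$, $\mathrm{dis}\,R<\epsilon$, and $(p^r,p'^r)\in R$ for $r=1,\dots,m$. The sequence $(X_n,d_n,\{p_n^k\}_k)$ GH-converges to $(X,d,\{p^k\}_k)$ if for every $m\in\mathbb{N}$ and $\delta>0$ there is $n_0$ such that for every $n\ge n_0$ there exists an $(m,\delta)$ $X_n$–$X$ quasi-correspondence. *)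

(* Defs.v *)
From mathcomp Require Import all_boot all_order all_algebra.
From mathcomp Require Import all_classical all_reals all_analysis.

Set Implicit Arguments.
Unset Strict Implicit.
Unset Printing Implicit Defensive.

Import Order.TTheory GRing.Theory Num.Theory.
Import numFieldNormedType.Exports.

Local Open Scope classical_set_scope.
Local Open Scope ring_scope.

(* Sequences are indexed from 0: p k stands for the mathematical p^(k+1),
   so that p^1, ..., p^m is the image p @` `I_m. *)

Section Chronology.
Context {R : realType} {X : Type} (d : X -> X -> R).

Definition chron_rel (x y : X) : Prop := 0 < d x y.

Definition chron_future (A : set X) : set X :=
  [set y | exists2 x, A x & chron_rel x y].

Definition chron_past (A : set X) : set X :=
  [set y | exists2 x, A x & chron_rel y x].

Definition chron_diamond (A : set X) : set X := chron_future A `&` chron_past A.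

Definition chron_ge (eps : R) : set (X * X) := [set z | eps <= d z.1 z.2].

(* I_eps(p^1, ..., p^m), with A = {p^1, ..., p^m}. *)
Definition diamond_ge (eps : R) (A : set X) : set X :=
  [set x | exists a b, [/\ A a, A b, eps <= d a x & eps <= d x b]].

End Chronology.

(* The topology required to exist on a Lorentzian metric space is the one of the
   underlying topologicalType; it is unique in the presence of a generating
   sequence. *)
Record lorentzianMetricSpace (R : realType) := LorentzianMetricSpace {
  lms_sort :> topologicalType ;
  ldist : lms_sort -> lms_sort -> R ;
  ldist_ge0 : forall x y, 0 <= ldist x y ;
  ldist_reverse_triangle : forall x y z,
    0 < ldist x y -> 0 < ldist y z -> ldist x y + ldist y z <= ldist x z ;
  ldist_continuous :
    continuous (fun z : lms_sort * lms_sort => ldist z.1 z.2) ;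
  ldist_compact : forall (x y : lms_sort) (eps : R), 0 < eps ->
    compact (chron_ge ldist eps `&`
      (closure (chron_diamond ldist [set x; y]) `*`
       closure (chron_diamond ldist [set x; y]))) ;
  ldist_distinguishes : forall x y, x <> y ->
    exists z, ldist x z <> ldist y z \/ ldist z x <> ldist z y
}.

Arguments ldist {R X} : rename.

Definition generating {R : realType} {X : lorentzianMetricSpace R}
    (p : nat -> X) : Prop :=
  chron_diamond ldist (range p) = [set: X].

(* The set X^m. *)
Definition truncation {R : realType} {X : lorentzianMetricSpace R}
    (p : nat -> X) (m : nat) : set X :=
  closure (chron_diamond ldist (p @` `I_m)) `|` p @` `I_m.

(* The supremum is extended-real valued, since sup of an unbounded set of
   reals is 0 by convention. *)
Definition distortion {R : realType} {X Y : lorentzianMetricSpace R}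
    (C : set (X * Y)) : \bar R :=
  ereal_sup [set e | exists u v : X * Y,
    [/\ C u, C v & e = `|ldist u.1 v.1 - ldist u.2 v.2|%:E]].

Record quasi_correspondence {R : realType} {X Y : lorentzianMetricSpace R}
    (p : nat -> X) (q : nat -> Y) (m : nat) (eps : R) (C : set (X * Y)) : Prop := {
  qc_compact : compact C ;
  qc_sub : C `<=` truncation p m `*` truncation q m ;
  qc_fst : diamond_ge ldist eps (p @` `I_m) `<=` C.`1 ;
  qc_snd : diamond_ge ldist eps (q @` `I_m) `<=` C.`2 ;
  qc_distortion : (distortion C < eps%:E)%E ;
  qc_seq : forall r : nat, (r < m)%N -> C (p r, q r)
}.

Definition GH_converges {R : realType} (Xn : nat -> lorentzianMetricSpace R)
    (pn : forall n, nat -> Xn n) (X : lorentzianMetricSpace R) (p : nat -> X) : Prop :=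
  forall (m : nat) (delta : R), (0 < m)%N -> 0 < delta ->
    exists n0 : nat, forall n : nat, (n0 <= n)%N ->
      exists C : set (Xn n * X), quasi_correspondence (pn n) p m delta C.

(* Main.v *)
(* Pick for each n a quasi-correspondence C_n of quality (j(n)+1, 1/(j(n)+1)) with
   j(n) tending to infinity. For k outside A and k < n let q_n^k be a C_n-partner
   of q^k; the remaining free indices are spent on making q_n generating, which
   only takes cofinitely many terms of p_n, since every point has infinitely many
   terms of p_n in its past and in its future. *)
Require Import Defs.
From mathcomp Require Import all_boot all_order all_algebra.
From mathcomp Require Import all_classical all_reals all_analysis.
From mathcomp Require Import lra.

Set Implicit Arguments.
Unset Strict Implicit.
Unset Printing Implicit Defensive.

Import Order.TTheory GRing.Theory Num.Theory.
Import numFieldNormedType.Exports.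

Local Open Scope classical_set_scope.
Local Open Scope ring_scope.

(** Iterating a chosen successor gives an infinite chain, whose terms are distinct because [r] is
    transitive and irreflexive; it cannot stay in the finite complement of [S]. *)
Lemma serial_strict_cofinite (r : nat -> nat -> Prop) (S : set nat) :
  (forall x y z, r x y -> r y z -> r x z) -> (forall x, ~ r x x) ->
  (forall x, exists y, r x y) -> finite_set (~` S) ->
  forall x, exists2 y, S y & r x y.
Proof.
move=> rT rI rS finS x; have [s rs] := choice rS.
have rk i j : r (iter i s x) (iter (j + i.+1) s x).
  by elim: j => [|j IH] /=; [exact: rs | exact: rT IH (rs _)].
have inj_f : injective (fun i => iter i.+1 s x).
  move=> i j eij; case: (ltngtP i j) => // lij.
  - have := rk i.+1 (j - i.+1)%N; rewrite addnS subnK // -eij.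
    by move=> /rI.
  - have := rk j.+1 (i - j.+1)%N; rewrite addnS subnK // eij.
    by move=> /rI.
apply: contrapT => nS; apply: infinite_nat.
apply: sub_finite_set (finite_preimage (in2W inj_f) finS) => i _ Si.
by apply: nS; exists (iter i.+1 s x) => //; have := rk 0 i; rewrite addn1.
Qed.

Section Chronology.
Context {R : realType} {X : lorentzianMetricSpace R}.
Implicit Types (x y z : X) (p : nat -> X).

Lemma chron_relT x y z :
  chron_rel ldist x y -> chron_rel ldist y z -> chron_rel ldist x z.
Proof.
by move=> xy yz; apply: lt_le_trans (ldist_reverse_triangle xy yz); apply: addr_gt0.
Qed.

Lemma chron_relI x : ~ chron_rel ldist x x.
Proof.
move=> xx; have := ldist_reverse_triangle xx xx.
by rewrite /chron_rel in xx; lra.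
Qed.

Lemma chron_diamondS (A B : set X) :
  A `<=` B -> chron_diamond ldist A `<=` chron_diamond ldist B.
Proof.
by move=> AB x [[a /AB Ba ax] [b /AB Bb xb]]; split; [exists a | exists b].
Qed.

Lemma generating_between p : generating p -> forall x, exists a b,
  chron_rel ldist (p a) x /\ chron_rel ldist x (p b).
Proof.
move=> gp x; have := I : setT x; rewrite -gp.
by move=> -[[_ [a _ <-] ?] [_ [b _ <-] ?]]; exists a, b.
Qed.

(** Each term of [p] has further terms in its past and in its future, so a chain descending from
    [p a] and one ascending from [p b] both meet [S]. *)
Lemma generating_cofinite p (S : set nat) :
  generating p -> finite_set (~` S) -> chron_diamond ldist (p @` S) = setT.
Proof.
move=> /generating_between gp finS; apply/seteqP; split=> // x _.
have [a [b [ax xb]]] := gp x; split.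
- have [] := @serial_strict_cofinite
    (fun i j => chron_rel ldist (p j) (p i)) S _ _ _ finS a.
  + by move=> i j k ji kj; exact: chron_relT kj ji.
  + by move=> i; exact: chron_relI.
  + by move=> i; have [j [? [? _]]] := gp (p i); exists j.
  + by move=> j Sj ja; exists (p j); [exists j | exact: chron_relT ja ax].
- have [] := @serial_strict_cofinite
    (fun i j => chron_rel ldist (p i) (p j)) S _ _ _ finS b.
  + by move=> i j k; exact: chron_relT.
  + by move=> i; exact: chron_relI.
  + by move=> i; have [? [j [_ ?]]] := gp (p i); exists j.
  + by move=> j Sj bj; exists (p j); [exists j | exact: chron_relT xb bj].
Qed.

End Chronology.

Lemma distortion_lt_dist (R : realType) (X Y : lorentzianMetricSpace R)
    (C : set (X * Y)) (eps : R) : (distortion C < eps%:E)%E ->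
  forall u v, C u -> C v -> `|ldist u.1 v.1 - ldist u.2 v.2| < eps.
Proof.
move=> disC u v Cu Cv; rewrite -lte_fin; apply: le_lt_trans disC.
by apply: ereal_sup_ubound; exists u, v.
Qed.

(* The points of I_delta(q) lie in I_eps(p) as soon as the q's do, by the
   reverse triangle inequality, so cutting a correspondence for p down to the
   truncations of q keeps the projections large. *)
Lemma quasi_correspondence_change (R : realType) (X Y : lorentzianMetricSpace R)
    (p q : nat -> X) (p' q' : nat -> Y) (M m : nat) (eps delta : R)
    (C : set (X * Y)) :
  0 < eps -> eps < delta -> quasi_correspondence p p' M eps C ->
  (forall r, (r < m)%N -> C (q r, q' r)) ->
  (forall r, (r < m)%N -> exists a b, [/\ (a < M)%N, (b < M)%N,
      2 * eps <= ldist (p' a) (q' r) & 2 * eps <= ldist (q' r) (p' b)]) ->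
  exists D, quasi_correspondence q q' m delta D.
Proof.
move=> e0 ed [Cc Csub C1 C2 Cdis Cp] Cq qI; have dC := distortion_lt_dist Cdis.
pose clX := closure (chron_diamond ldist (q @` `I_m)).
pose clY := closure (chron_diamond ldist (q' @` `I_m)).
(* The pairs [(q r, q' r)] are added by hand, since they may lie outside the closed diamonds; being
   finitely many, they keep [D] compact. *)
pose D := C `&` (clX `*` clY) `|` (fun r => (q r, q' r)) @` `I_m.
have DC : D `<=` C by move=> u [[]|[r rm <-]] //; exact: Cq.
have inD u i j : C u -> (i < m)%N -> (j < m)%N ->
    0 < ldist (q i) u.1 -> 0 < ldist u.1 (q j) ->
    0 < ldist (q' i) u.2 -> 0 < ldist u.2 (q' j) -> D u.
  move=> Cu im jm qiu uqj qiu' uqj'; left; split=> //; split; apply: subset_closure.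
  - by split; [exists (q i) => //; exists i | exists (q j) => //; exists j].
  - by split; [exists (q' i) => //; exists i | exists (q' j) => //; exists j].
exists D; split.
- apply: compactU; last exact/finite_compact/finite_image/finite_II.
  apply: compact_closedI Cc _; apply: closedI.
  + by apply: (closed_comp (f := fst)); [move=> ? _; exact: cvg_fst | exact: closed_closure].
  + by apply: (closed_comp (f := snd)); [move=> ? _; exact: cvg_snd | exact: closed_closure].
- move=> u [[_ [? ?]]|[r rm <-]]; first by split; left.
  by split; right; exists r.
- move=> x [_ [_ [[i im <-] [j jm <-] qix xqj]]].
  have [a [_ [aM _ aqi _]]] := qI i im; have [_ [b [_ bM _ qjb]]] := qI j jm.
  (* The margin [2 * eps] is assumed on the primed side only. The distortion takes off less than
     [eps], so more than [eps] remains between [p a] and [q i] and between [q j] and [p b]. *)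
  have := dC _ _ (Cp a aM) (Cq i im); have := dC _ _ (Cq j jm) (Cp b bM).
  rewrite !ltr_norml /= => /andP[hb _] /andP[ha _].
  have h1 := ldist_reverse_triangle (x := p a) (y := q i) (z := x).
  have h2 := ldist_reverse_triangle (x := x) (y := q j) (z := p b).
  have [|y Cxy] := C1 x.
    by exists (p a), (p b); split; [exists a | exists b | lra | lra].
  (* Passing from [x] to [y] lowers a distance of at least [delta] by less than [eps < delta], so it
     stays positive. *)
  exists y; apply: (inD _ i j) => //=; [lra | lra | |].
  + by have := dC _ _ (Cq i im) Cxy; rewrite !ltr_norml /= => /andP[_ ?]; lra.
  + by have := dC _ _ Cxy (Cq j jm); rewrite !ltr_norml /= => /andP[_ ?]; lra.
- move=> y [_ [_ [[i im <-] [j jm <-] qiy yqj]]].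
  have [a [_ [aM _ aqi _]]] := qI i im; have [_ [b [_ bM _ qjb]]] := qI j jm.
  have h1 := ldist_reverse_triangle (x := p' a) (y := q' i) (z := y).
  have h2 := ldist_reverse_triangle (x := y) (y := q' j) (z := p' b).
  have [|x Cxy] := C2 y.
    by exists (p' a), (p' b); split; [exists a | exists b | lra | lra].
  exists x; apply: (inD _ i j) => //=; [| | lra | lra].
  + by have := dC _ _ (Cq i im) Cxy; rewrite !ltr_norml /= => /andP[? _]; lra.
  + by have := dC _ _ Cxy (Cq j jm); rewrite !ltr_norml /= => /andP[? _]; lra.
- apply: (@le_lt_trans _ _ (distortion C)).
    by apply: ereal_sup_le => _ [u [v [/DC Cu /DC Cv ->]]]; exists u, v.
  by apply: lt_trans Cdis _; rewrite lte_fin.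
- by move=> r rm; right; exists r.
Qed.

(** Take for [j n] the largest [J <= n] with [P J n]; the bound [n] makes the maximum exist. A fixed
    [J] is a candidate for all large [n], whence [J <= j n]. *)
Lemma diagonal_index (P : nat -> nat -> Prop) :
  (forall J, \forall n \near \oo, P J n) ->
  exists j : nat -> nat, forall J, \forall n \near \oo, (J <= j n)%N /\ P (j n) n.
Proof.
move=> evP.
have /choice[j jP] : forall n, exists j, forall J, (J <= n)%N -> P J n ->
    (J <= j)%N /\ P j n.
  move=> n; have [[J0 [J0n PJ0]]|nP] := pselect (exists J, (J <= n)%N /\ P J n); last first.
    by exists 0%N => J Jn PJ; case: nP; exists J.
  have exQ : exists J, (J <= n)%N && `[< P J n >].
    by exists J0; rewrite J0n; apply/asboolP.
  have [|J /andP[_ /asboolP PJ] Jmax] := ex_maxnP (m := n) exQ.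
    by move=> i /andP[].
  exists J => i ile Pi; split=> //; apply: Jmax; rewrite ile; exact/asboolP.
exists j => J; near=> n; apply: jP.
- by near: n; exact: nbhs_infty_ge.
- by near: n; exact: evP.
Unshelve. all: by end_near. Qed.

Lemma GH_converges_diagonal (R : realType) (Xn : nat -> lorentzianMetricSpace R)
    (pn : forall n, nat -> Xn n) (X : lorentzianMetricSpace R) (p : nat -> X) :
  GH_converges pn p ->
  exists (j : nat -> nat) (C : forall n, set (Xn n * X)),
    forall J, \forall n \near \oo, (J <= j n)%N /\
      quasi_correspondence (pn n) p (j n).+1 (j n).+1%:R^-1 (C n).
Proof.
move=> cvgp.
have [J|j jP] := @diagonal_index (fun J n => exists C : set (Xn n * X),
    quasi_correspondence (pn n) p J.+1 J.+1%:R^-1 C).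
  have [|n0 n0P] := cvgp J.+1 J.+1%:R^-1 isT; first by rewrite invr_gt0.
  by exists n0.
exists j.
(* The default [set0] is used for finitely many [n] at most. *)
have exC n : exists C : set (Xn n * X),
    (exists C, quasi_correspondence (pn n) p (j n).+1 (j n).+1%:R^-1 C) ->
    quasi_correspondence (pn n) p (j n).+1 (j n).+1%:R^-1 C.
  by have [[C CP]|nC] := pselect (exists C : set (Xn n * X),
    quasi_correspondence (pn n) p (j n).+1 (j n).+1%:R^-1 C); [exists C | exists set0].
exists (fun n => projT1 (cid (exC n))) => J.
apply: filterS (jP J) => n [Jj Cn]; split=> //.
by case: (cid (exC n)) => /= D; exact.
Qed.

(** With [g] an increasing enumeration inside [B] and [e] a left inverse, [u (e k)] for [k] in [B]
    runs over all terms of a sequence [u]. *)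
Lemma infinite_retraction (B : set nat) : infinite_set B ->
  exists g e : nat -> nat, cancel g e /\ forall j, B (g j).
Proof.
move=> infB.
have [x|g [ginc _ gB]] := infinite_increasing_seq_wf _ infB 0%N.
  by apply: sub_finite_set (finite_II x.+1) => y /=.
have /choice[e eP] k : exists j, (exists i, g i = k) -> g j = k.
  by have [[i <-]|ni] := pselect (exists i, g i = k); [exists i | exists 0%N].
exists g, e; split=> // j.
have injg : injective g by apply: inc_inj.
by apply: injg; apply: eP; exists j.
Qed.

Theorem theorem6p15 (R : realType)
    (Xn : nat -> lorentzianMetricSpace R) (pn : forall n : nat, nat -> Xn n)
    (X : lorentzianMetricSpace R) (p : nat -> X) (q : nat -> X)
    (pn_gen : forall n : nat, generating (pn n))
    (p_gen : generating p)
    (pn_cvg : GH_converges pn p)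
    (q_gen : generating q) :
  (exists qn : forall n : nat, nat -> Xn n,
      (forall n : nat, generating (qn n)) /\ GH_converges qn q) /\
  (forall (A : set nat) (rho : nat -> nat),
      (forall k : nat, A k -> q k = p (rho k)) ->
      finite_set (~` (rho @` A)) \/ infinite_set (~` A) ->
      exists qn : forall n : nat, nat -> Xn n,
        [/\ forall n : nat, generating (qn n),
            GH_converges qn q &
            forall n k : nat, A k -> qn n k = pn n (rho k)]).
Proof.
suff main : forall (A : set nat) (rho : nat -> nat),
      (forall k : nat, A k -> q k = p (rho k)) ->
      finite_set (~` (rho @` A)) \/ infinite_set (~` A) ->
      exists qn : forall n : nat, nat -> Xn n,
        [/\ forall n : nat, generating (qn n),
            GH_converges qn q &
            forall n k : nat, A k -> qn n k = pn n (rho k)].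
  (* The first claim is the case of empty [A], where condition (b) holds. *)
  split=> //; have [||qn [? ? _]] := main set0 id; last by exists qn.
  - by [].
  - by right; rewrite setC0; exact: infinite_nat.
move=> A rho qA AP.
have [j [C jC]] := GH_converges_diagonal pn_cvg.
(* Every tail of the free indices runs, through e, over cofinitely many indices. *)
have [e eP] : exists e : nat -> nat, finite_set (~` (rho @` A)) \/
    exists2 g, cancel g e & forall i, ~ A (g i).
  case: AP => [finA|/infinite_retraction[g [e [ge gA]]]]; first by exists id; left.
  by exists e; right; exists g.
(* The default [pn n 0] stands in when [q k] has no partner in [C n]. *)
have exy n k : exists y : Xn n, (exists x, C n (x, q k)) -> C n (y, q k).
  by have [[y Cy]|nCy] := pselect (exists x, C n (x, q k)); [exists y | exists (pn n 0%N)].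
pose y n k := projT1 (cid (exy n k)).
have yP n k : (exists x, C n (x, q k)) -> C n (y n k, q k).
  by rewrite /y; case: (cid (exy n k)).
pose qn n k := if `[< A k >] then pn n (rho k)
               else if (k < n)%N then y n k else pn n (e k).
have qnA n k : A k -> qn n k = pn n (rho k) by move=> Ak; rewrite /qn asboolT.
exists qn; split=> //.
  move=> n; apply/seteqP; split=> // x _.
  case: eP => [finA|[g ge gA]].
    have : setT x by []; rewrite -(generating_cofinite (pn_gen n) finA).
    apply: chron_diamondS => _ [_ [k Ak <-] <-].
    by exists k => //; exact: qnA.
  (* If [n <= g i], the free index [g i] carries [pn n (e (g i)) = pn n i]; as [g] is injective,
     this misses finitely many [i] only. *)
  have finS : finite_set (~` [set i | (n <= g i)%N]).
    apply: sub_finite_set (finite_preimage (in2W (can_inj ge)) (finite_II n)).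
    by move=> i /= /negP; rewrite -ltnNge.
  have : setT x by []; rewrite -(generating_cofinite (pn_gen n) finS).
  apply: chron_diamondS => _ [i /= ni <-].
  by exists (g i) => //; rewrite /qn asboolF // ltnNge ni ge.
move=> m delta m0 delta0.
have near_q (r : 'I_m) : \forall J \near \oo, (rho r <= J)%N /\ exists a b,
    [/\ (a <= J)%N, (b <= J)%N, 2 * J.+1%:R^-1 <= ldist (p a) (q r) &
      2 * J.+1%:R^-1 <= ldist (q r) (p b)].
  have [a [b [aq qb]]] := generating_between p_gen (q r).
  near=> J; split; first by near: J; exact: nbhs_infty_ge.
  exists a, b; split; [by near: J; exact: nbhs_infty_ge | by near: J; exact: nbhs_infty_ge | |].
  - rewrite mulrC -ler_pdivlMr //; apply: ltW; near: J.
    by apply: near_infty_natSinv_lt (PosNum (divr_gt0 aq _)).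
  - rewrite mulrC -ler_pdivlMr //; apply: ltW; near: J.
    by apply: near_infty_natSinv_lt (PosNum (divr_gt0 qb _)).
have [J _ JP] := filterI (near_infty_natSinv_lt (PosNum delta0)) (filter_forall _ near_q).
(* Having [m <= n] puts every free [r < m] in the branch [k < n], where [qn n r] is a partner. *)
have [n0 _ n0P] := filterI (nbhs_infty_ge m) (jC J).
exists n0 => n /n0P[/= mn [Jj Cn]].
have [/= jdelta jq] := JP _ Jj.
apply: (quasi_correspondence_change _ jdelta Cn) => [|r rm|r rm].
- by rewrite invr_gt0.
- have [/= rhor [a [b [aj bj paq qpb]]]] := jq (Ordinal rm).
  (* A prescribed term is paired with [q r = p (rho r)] because [rho r <= j n]. For a free one,
     [q r] lies deep enough between [p a] and [p b] to belong to the second projection of [C n]. *)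
  have [Ar|nAr] := pselect (A r).
    by rewrite qnA // qA //; apply: (qc_seq Cn).
  rewrite /qn asboolF // (leq_trans rm mn); apply: yP.
  have [|x /= Cx] := @qc_snd _ _ _ _ _ _ _ _ Cn (q r); last by exists x.
  have : 0 < (j n).+1%:R^-1 :> R by rewrite invr_gt0.
  move: (_^-1) paq qpb => v paq qpb v0.
  by exists (p a), (p b); split; [exists a | exists b | lra | lra].
- by have [_] := jq (Ordinal rm).
Unshelve. all: by end_near. Qed.
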